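(* Let $S$ be a set of $n>3$ points in general position in the plane with rectilinear crossing number $\overline{cr}(S)=\alpha\binom{n}{4}$. Then the polynomial $p_E(z)=\sum_{k=0}^{n-3} E_{\le k} z^k$ has a root of modulus at least $\frac{3+\alpha}{9-\alpha}$.
   Context: General position means no three points of $S$ are collinear and no four points of $S$ are cocircular. A $j$-edge of $S$ is a directed line through two points of $S$ such that the open half-plane to its right contains exactly $j$ points of $S$; $e_j$ is their number and $E_{\le k}=\sum_{j=0}^k e_j$. $\overline{cr}(S)$ is the number of crossing pairs of edges in the straight-line drawing of $K_n$ on $S$ (equivalently, the number of convex quadrilaterals with vertices in $S$). *)

(* Defs.v *)
From mathcomp Require Import all_boot all_order all_algebra.
From mathcomp Require Import finmap complex boolp reals.

Set Implicit Arguments.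
Unset Strict Implicit.
Unset Printing Implicit Defensive.

Import Order.TTheory GRing.Theory Num.Theory.
Local Open Scope ring_scope.

Definition collinear (R : realType) (p q r : R * R) : Prop :=
  exists a b c : R, (a, b) <> (0, 0) /\
    [/\ a * p.1 + b * p.2 = c, a * q.1 + b * q.2 = c & a * r.1 + b * r.2 = c].

Definition on_circle (R : realType) (c : R * R) (rho : R) (p : R * R) : Prop :=
  (p.1 - c.1) ^+ 2 + (p.2 - c.2) ^+ 2 = rho ^+ 2.

Definition cocircular (R : realType) (p q r s : R * R) : Prop :=
  exists (c : R * R) (rho : R), 0 < rho /\
    [/\ on_circle c rho p, on_circle c rho q, on_circle c rho r
      & on_circle c rho s].

Definition general_position (R : realType) (S : {fset (R * R)}) : Prop :=
  (forall p q r : S, uniq [:: p; q; r] ->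
     ~ collinear (val p) (val q) (val r)) /\
  (forall p q r s : S, uniq [:: p; q; r; s] ->
     ~ cocircular (val p) (val q) (val r) (val s)).

(* The determinant of (q - p, x - p) is negative exactly when x is
   in the open half-plane to the right of the line pq directed from p to q. *)
Definition right_of (R : realType) (p q x : R * R) : bool :=
  (q.1 - p.1) * (x.2 - p.2) - (q.2 - p.2) * (x.1 - p.1) < 0.

(* A directed line through two points of S is encoded by the ordered pair of
   these points; when no three points of S are collinear, distinct ordered
   pairs give distinct directed lines. *)
Definition is_jedge (R : realType) (S : {fset (R * R)}) (j : nat)
    (pq : S * S) : bool :=
  (pq.1 != pq.2) &&
  (#|[set x : S | right_of (val pq.1) (val pq.2) (val x)]| == j).

Definition num_jedges (R : realType) (S : {fset (R * R)}) (j : nat) : nat :=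
  #|[set pq : S * S | is_jedge j pq]|.

Definition num_le_kedges (R : realType) (S : {fset (R * R)}) (k : nat) : nat :=
  (\sum_(0 <= j < k.+1) num_jedges S j)%N.

Definition open_segment (R : realType) (p q x : R * R) : Prop :=
  exists t : R, [/\ 0 < t < 1, x.1 = (1 - t) * p.1 + t * q.1
                  & x.2 = (1 - t) * p.2 + t * q.2].

(* An edge of the complete graph on S is a two-element subset of S, drawn as
   the segment between its endpoints. *)
Definition edge_interior (R : realType) (S : {fset (R * R)}) (e : {set S})
    (x : R * R) : Prop :=
  exists a b : S,
    [/\ a <> b, e = [set a; b] & open_segment (val a) (val b) x].

Definition edges_cross (R : realType) (S : {fset (R * R)})
    (e f : {set S}) : Prop :=
  e <> f /\ exists x : R * R, edge_interior e x /\ edge_interior f x.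

Definition crossing_number (R : realType) (S : {fset (R * R)}) : nat :=
  #|[set P : {set {set S}} |
      `[< exists e f : {set S}, P = [set e; f] /\ edges_cross e f >]]|.

Definition pE (R : realType) (S : {fset (R * R)}) : {poly R[i]} :=
  \sum_(0 <= k < (#|` S| - 3).+1%N) (num_le_kedges S k)%:R *: 'X^k.

(* Main.v *)
Require Import Defs.
From mathcomp Require Import all_boot all_order all_algebra.
From mathcomp Require Import finmap complex boolp reals.
From mathcomp Require Import ring lra zify.

Set Implicit Arguments.
Unset Strict Implicit.
Unset Printing Implicit Defensive.

Import Order.TTheory GRing.Theory Num.Theory.
Local Open Scope ring_scope.

(* If all roots z of p_E lay in the disc |z| < r, where r = (3 + alpha) /
   (9 - alpha) <= 1, then each of the n - 3 numbers 1 / (1 - z) would have real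
   part greater than 1 / (1 + r) = (9 - alpha) / 12. Their sum is
   p_E'(1) / p_E(1), and double counting gives p_E(1) = 3 C(n, 3) and
   p_E'(1) = 9 C(n, 4) - cr(S) = (9 - alpha) C(n, 4), so their mean is
   (9 - alpha) / 12, a contradiction. The value of p_E'(1) comes from counting
   the pairs of points on opposite sides of each line: among four points, the
   number of separating pairs plus the number of crossings is always 3. Only
   the inequalities p_E'(1) <= 9 C(n, 4) - cr(S) and alpha <= 3 are needed. *)

(** * Logarithmic derivative at 1 and the moduli of roots *)

Lemma horner_deriv_prod_XsubC (F : fieldType) (s : seq F) (x : F) :
  x \notin s ->
  (\prod_(z <- s) ('X - z%:P))^`().[x] =
  (\prod_(z <- s) ('X - z%:P)).[x] * \sum_(z <- s) (x - z)^-1.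
Proof.
elim: s => [|z s IHs]; first by rewrite !big_nil derivC horner0 mulr0.
rewrite inE negb_or => /andP[xz /IHs IH].
rewrite !big_cons derivM derivXsubC mul1r !hornerE IH mulrDr.
congr (_ + _); last by rewrite mulrA.
by rewrite mulrAC mulfV ?mul1r // subr_eq0.
Qed.

(** With [z = x + i y] the real part is [(1 - x) / ((1 - x)^2 + y^2)]. Since [y^2 < r^2 - x^2], the
    claim reduces to [(r + x) (1 - r) >= 0], which holds because [- r < x] and [r <= 1]. *)
Lemma Re_inv_subr1_gt (R : rcfType) (r : R) (z : R[i]) :
  r <= 1 -> `|z| < r%:C%C -> (1 + r)^-1 < complex.Re (1 - z)^-1.
Proof.
case: z => x y r1; rewrite normc_def /= ltcR => zr.
have r0 : 0 < r by apply: le_lt_trans zr; apply: sqrtr_ge0.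
have xyr : x ^+ 2 + y ^+ 2 < r ^+ 2.
  rewrite -(ltr_pXn2r (n := 2)) ?nnegrE ?sqrtr_ge0 ?(ltW r0) // in zr.
  by rewrite sqr_sqrtr ?addr_ge0 ?sqr_ge0 in zr.
have xr : - r < x by nra.
have xr' : x < r by nra.
rewrite sub0r.
have dpos : 0 < (1 - x) ^+ 2 + (- y) ^+ 2 by nra.
by rewrite ltr_pdivlMr // mulrC ltr_pdivrMr; nra.
Qed.

Lemma sumr_gt_size (R : realDomainType) (T : eqType) (s : seq T) (f : T -> R)
    (c : R) :
  s != [::] -> {in s, forall x, c < f x} ->
  (size s)%:R * c < \sum_(x <- s) f x.
Proof.
have le_sum t : {in t, forall x, c < f x} ->
    (size t)%:R * c <= \sum_(x <- t) f x.
  elim: t => [|y t IHt] ft; first by rewrite big_nil mul0r.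
  rewrite big_cons /= mulrSr mulrDl mul1r addrC.
  by rewrite lerD ?IHt ?ltW ?ft ?mem_head // => x xt; rewrite ft // inE xt orbT.
case: s => // y s _ fs; rewrite big_cons /= mulrSr mulrDl mul1r addrC.
by rewrite ltr_leD ?le_sum ?fs ?mem_head // => x xs; rewrite fs // inE xs orbT.
Qed.

Lemma exists_root_norm_ge (R : rcfType) (p : {poly R[i]}) (m : nat)
    (A B r : R) :
  size p = m.+2 -> 0 < A -> p.[1] = A%:C%C -> p^`().[1] = B%:C%C ->
  0 <= r <= 1 -> B * (1 + r) <= m.+1%:R * A ->
  exists z : R[i], root p z /\ r%:C%C <= `|z|.
Proof.
move=> szp A0 pA pB /andP[r0 r1] BA.
have [s ps] := closed_field_poly_normal p.
have p0 : p != 0 by rewrite -size_poly_eq0 szp.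
have l0 : lead_coef p != 0 by rewrite lead_coef_eq0.
(* Roots are listed with multiplicity. The list is nonempty, which the strict inequality from
   [sumr_gt_size] requires. *)
have szs : size s = m.+1.
  by move: szp; rewrite ps size_scale // size_prod_XsubC => -[].
have rs z : z \in s -> root p z by rewrite ps rootZ // root_prod_XsubC.
have [/hasP[z zs rz]|/hasPn nrs] := boolP (has (fun z => r%:C%C <= `|z|) s).
  by exists z; split=> //; apply: rs.
have {}nrs z : z \in s -> `|z| < r%:C%C.
  move=> /nrs; rewrite real_ltNge ?normr_real //.
  by rewrite ger0_real // ler0c.
have n1 : 1 \notin s.
  apply/negP => /rs; rewrite /root pA => /eqP[] /eqP.
  by rewrite gt_eqF.
have eS : \sum_(z <- s) (1 - z)^-1 = (B / A)%:C%C.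
  have : p^`().[1] = p.[1] * \sum_(z <- s) (1 - z)^-1.
    by rewrite ps derivZ !hornerZ horner_deriv_prod_XsubC // mulrA.
  rewrite pA pB => e.
  have A0' : A%:C%C != 0 :> R[i] by rewrite (inj_eq (@complexI _)) gt_eqF.
  apply: (mulfI A0'); rewrite -e -rmorphM mulrCA divff ?mulr1 //.
  by rewrite gt_eqF.
have : m.+1%:R / (1 + r) < \sum_(z <- s) complex.Re (1 - z)^-1.
  rewrite -szs; apply: sumr_gt_size; first by rewrite -size_eq0 szs.
  by move=> z /nrs; apply: Re_inv_subr1_gt.
have <- : complex.Re (\sum_(z <- s) (1 - z)^-1)
          = \sum_(z <- s) complex.Re (1 - z)^-1.
  by apply: (big_morph (@complex.Re R)) => // -[? ?] [].
rewrite eS /= ltr_pdivlMr // mulrAC ltr_pdivrMr; last by lra.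
by rewrite ltNge BA.
Qed.

(** * Sums of indicators *)

Lemma sum_geq_indicator (m k : nat) :
  (k <= m)%N -> (\sum_(0 <= j < m) (k <= j) = m - k)%N.
Proof.
elim: m => [|m IHm]; first by rewrite big_nil.
rewrite leq_eqVlt => /predU1P[->|]; last first.
  by rewrite ltnS => km; rewrite big_nat_recr //= IHm // km subSn // addn1.
by rewrite subnn big_nat big1 // => j /andP[_ jm]; rewrite leqNgt jm.
Qed.

(** A difference of triangular numbers, written as a sum to avoid truncated subtraction. *)
Lemma sum_mul_geq_indicator (m k : nat) :
  (k <= m)%N -> (\sum_(0 <= j < m) j * (k <= j) + 'C(k, 2) = 'C(m, 2))%N.
Proof.
elim: m => [|m IHm]; first by rewrite leqn0 big_nil => /eqP->.
rewrite leq_eqVlt => /predU1P[->|]; last first.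
  rewrite ltnS => km; rewrite big_nat_recr //= km muln1 addnAC IHm //.
  by rewrite binS bin1.
by rewrite big_nat big1 // => j /andP[_ jm]; rewrite leqNgt jm muln0.
Qed.

Lemma mul2_bin2 (m : nat) : (2 * 'C(m, 2) = m * m.-1)%N.
Proof.
rewrite mul2n bin2 -divn2 -muln2 divnK //.
by case: m => // m; rewrite dvdn2 oddM /= andNb.
Qed.

Lemma sum_eq_indicator (m k : nat) :
  (\sum_(0 <= j < k.+1 | m == j) 1 = (m <= k))%N.
Proof.
rewrite big_mkord -ltnS; case: ltnP => [mk|km].
  by rewrite (big_pred1 (Ordinal mk)) // => i; rewrite /= eq_sym.
by rewrite big_pred0 // => i; rewrite gtn_eqF // (leq_trans _ km).
Qed.

(** * Separating pairs and crossings for an abstract orientation *)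

Section Orientation.

(** [D p q x] models twice the signed area of the triangle [p q x]; [D_plucker] is the linear
    relation among the areas of the four triangles on a quadruple. *)
Variables (R : realDomainType) (V : finType) (D : V -> V -> V -> R).
Hypothesis D_swap : forall p q x, D q p x = - D p q x.
Hypothesis D_cycle : forall p q x, D q x p = D p q x.
Hypothesis D_neq0 : forall p q x, uniq [:: p; q; x] -> D p q x != 0.
Hypothesis D_plucker : forall a b c d,
  D b c d - D a c d + D a b d - D a b c = 0.

Local Notation n := #|V|.

Definition right_pts p q := [set x | D p q x < 0].
Local Notation r p q := #|right_pts p q|.

Definition separates a b c d := D a b c * D a b d < 0.
(** For four points in general position this expresses that the segments [ab] and [cd] meet in their
    interiors. *)
Definition crosses a b c d := separates a b c d && separates c d a b.

Let D_diag p x : D p p x = 0.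
Proof. by have := D_swap p p x; lra. Qed.

Lemma card_right_swap p q : p != q -> (r p q + r q p + 2 = n)%N.
Proof.
move=> pq.
have e1 y : (\sum_(x : V) (x == y) = 1)%N.
  by rewrite (bigD1 y) //= eqxx big1 // => x /negPf ->.
have cE (A : {set V}) : (#|A| = \sum_x (x \in A))%N.
  by rewrite -sum1_card big_mkcond; apply: eq_bigr => x _; case: ifP.
(* The 2 becomes the indicators of [p] and [q], summed over all points. The identity then holds
   point by point: each point is [p], is [q], or lies on exactly one side. *)
rewrite !cE -[2%N]/(1 + 1)%N -{1}(e1 p) -(e1 q) -!big_split /= -sum1_card.
apply: eq_bigr => x _; rewrite !inE (D_swap p q) oppr_lt0.
case: (eqVneq x p) => [->|xp]; first by rewrite D_cycle D_diag ltxx (negPf pq).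
case: (eqVneq x q) => [->|xq]; first by rewrite -D_cycle D_diag ltxx.
have : D p q x != 0.
  by apply: D_neq0; rewrite /= !inE negb_or pq !(eq_sym _ x) xp xq.
by case: ltrgtP.
Qed.

Lemma separates_uniq a b c d : separates a b c d -> uniq [:: a; b; c; d].
Proof.
rewrite /separates mulr_lt0 => /and3P[abc abd cd] /=.
have nab : a != b by apply: contra_neq abc => ->; rewrite D_diag.
have nac : a != c.
  by apply: contra_neq abc => ->; rewrite D_cycle D_diag.
have nbc : b != c by apply: contra_neq abc => ->; rewrite -D_cycle D_diag.
have nad : a != d.
  by apply: contra_neq abd => ->; rewrite D_cycle D_diag.
have nbd : b != d by apply: contra_neq abd => ->; rewrite -D_cycle D_diag.
have ncd : c != d by apply: contraTneq cd => ->; rewrite addbb.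
by rewrite !inE !negb_or nab nac nad nbc nbd ncd.
Qed.

(** The six separation terms run over the pairs among the four points, the three crossing terms over
    the ways to split them into two pairs. In convex position the two diagonals separate and cross:
    2 + 1. Otherwise the three edges at the inner point separate and nothing crosses: 3 + 0. With a
    repeated point every term vanishes. *)
Lemma separates_crosses_le a b c d :
  (separates a b c d + separates c d a b + separates a c b d +
   separates b d a c + separates a d b c + separates b c a d +
   crosses a b c d + crosses a c b d + crosses a d b c
   <= 3 * uniq [:: a; b; c; d])%N.
Proof.
have [U|nU] := boolP (uniq [:: a; b; c; d]); last first.
  have sF x y z t : perm_eq [:: x; y; z; t] [:: a; b; c; d] ->
      separates x y z t = false.
    move=> P; apply: contraNF nU => /separates_uniq.
    by rewrite (perm_uniq P).
  rewrite /crosses !sF //; apply/permP => P /=; lia.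
(* By antisymmetry all nine terms depend only on the signs of these four determinants. *)
have [t0 w0 v0 k0] :
    [/\ D a b c != 0, D a b d != 0, D a c d != 0 & D b c d != 0].
  by split; apply: D_neq0; move: U; rewrite /= !inE !negb_or;
    do !case: eqP => //=.
rewrite /crosses /separates !mulr_lt0.
have -> : D c d a = D a c d by rewrite D_cycle.
have -> : D c d b = D b c d by rewrite D_cycle.
have -> : D a c b = - D a b c by rewrite D_cycle D_swap.
have -> : D b d a = D a b d by rewrite D_cycle.
have -> : D b d c = - D b c d by rewrite D_cycle D_swap.
have -> : D a d b = - D a b d by rewrite D_cycle D_swap.
have -> : D a d c = - D a c d by rewrite D_cycle D_swap.
have -> : D b c a = D a b c by rewrite D_cycle.
rewrite !oppr_eq0 !oppr_lt0 t0 w0 v0 k0 /=.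
have gtE (x : R) : x != 0 -> (0 < x) = ~~ (x < 0) by case: (ltrgtP x 0).
rewrite !gtE //; have := D_plucker a b c d.
(* Among the 16 sign patterns, the two alternating ones violate [D_plucker]. *)
case: (ltrgtP (D a b c) 0) t0 => // ? _;
  case: (ltrgtP (D a b d) 0) w0 => // ? _;
  case: (ltrgtP (D a c d) 0) v0 => // ? _;
  case: (ltrgtP (D b c d) 0) k0 => // ? _ //=; lra.
Qed.

Local Notation sum4 F := 
  (\sum_(a : V) \sum_(b : V) \sum_(c : V) \sum_(d : V) F a b c d)%N.

Lemma sum4_swap12 (F : V -> V -> V -> V -> nat) :
  sum4 (fun a b c d => F b a c d) = sum4 F.
Proof. exact: exchange_big. Qed.

Lemma sum4_swap23 (F : V -> V -> V -> V -> nat) :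
  sum4 (fun a b c d => F a c b d) = sum4 F.
Proof. by apply: eq_bigr => a _; apply: exchange_big. Qed.

Lemma sum4_swap34 (F : V -> V -> V -> V -> nat) :
  sum4 (fun a b c d => F a b d c) = sum4 F.
Proof.
by apply: eq_bigr => a _; apply: eq_bigr => b _; apply: exchange_big.
Qed.

Lemma sum4_swap_pairs (F : V -> V -> V -> V -> nat) :
  sum4 (fun a b c d => F c d a b) = sum4 F.
Proof.
by rewrite (sum4_swap23 (fun a b c d => F b d a c))
   (sum4_swap34 (fun a b c d => F b c a d))
   (sum4_swap12 (fun a b c d => F a c b d)) sum4_swap23.
Qed.

Lemma sum4_uniq :
  (sum4 (fun a b c d => uniq [:: a; b; c; d] : nat)
   = n * n.-1 * (n.-2 * (n - 3)))%N.
Proof.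
(* A list of [m] distinct points extends by one new point in [n - m] ways. *)
have sub (s : seq V) m : (uniq s -> size s = m) ->
    (\sum_d (uniq (rcons s d)) = (uniq s) * (n - m))%N.
  move=> sz; under eq_bigr do rewrite rcons_uniq.
  case: (boolP (uniq s)) => [us|_]; last first.
    by rewrite big1 // => d _; rewrite andbF.
  rewrite mul1n -sz // -(card_uniqP us) -(cardC (mem s)) addKn -sum1_card.
  rewrite [RHS]big_mkcond; apply: eq_bigr => d _.
  by rewrite andbT inE; case: (d \in s).
transitivity (\sum_(a : V) \sum_(b : V) \sum_(c : V)
    (uniq [:: a; b; c]) * (n - 3))%N.
  by do 3!(apply: eq_bigr => ? _); apply: (sub [:: _; _; _]).
under eq_bigr => a _ do under eq_bigr => b _ do
  rewrite -big_distrl (sub [:: a; b] 2%N) //=.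
under eq_bigr => a _ do rewrite -!big_distrl (sub [:: a] 1%N) //=.
by rewrite -!big_distrl sum_nat_const /= muln1 subn1 subn2 -mulnA.
Qed.

(** In a separated pair one point is right of [pq] and the other right of [qp]; the factor 2 is the
    choice of which comes first. *)
Lemma sum_separates p q :
  (\sum_c \sum_d separates p q c d = 2 * (r p q * r q p))%N.
Proof.
have cE (A : {set V}) : (#|A| = \sum_x (x \in A))%N.
  by rewrite -sum1_card big_mkcond; apply: eq_bigr => x _; case: ifP.
rewrite mul2n -addnn {2}(mulnC (r p q)) !cE !big_distrlr /= -big_split /=.
apply: eq_bigr => c _; rewrite -big_split /=; apply: eq_bigr => d _.
rewrite /separates mulr_lt0 !inE !(D_swap p q) !oppr_lt0.
by case: (ltrgtP (D p q c) 0); case: (ltrgtP (D p q d) 0).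
Qed.

(** This is [separates_crosses_le] summed over all quadruples. Renaming variables makes the six
    separation sums equal, and likewise the three crossing sums; 12 is 6 times the 2 of
    [sum_separates]. *)
Lemma sum_right_crosses_le :
  (12 * (\sum_p \sum_q r p q * r q p)
   + 3 * sum4 (fun a b c d => crosses a b c d : nat)
   <= 3 * (n * n.-1 * (n.-2 * (n - 3))))%N.
Proof.
have -> : (12 * (\sum_p \sum_q r p q * r q p)
           = 6 * sum4 (fun a b c d => separates a b c d : nat))%N.
  rewrite -[12%N]/(6 * 2)%N -mulnA big_distrr; congr (_ * _)%N.
  apply: eq_bigr => p _; rewrite big_distrr; apply: eq_bigr => q _.
  by rewrite sum_separates.
have s1 F : sum4 (fun a b c d => F a d b c) = sum4 F.
  by rewrite (sum4_swap34 (fun a b c d => F a c b d)) sum4_swap23.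
have s2 F : sum4 (fun a b c d => F b d a c) = sum4 F.
  by rewrite -(sum4_swap23 (fun a b c d => F b d a c)) sum4_swap_pairs.
have s3 F : sum4 (fun a b c d => F b c a d) = sum4 F.
  by rewrite (sum4_swap12 (fun a b c d => F a c b d)) sum4_swap23.
have E (F G : V -> V -> V -> V -> nat) :
  (sum4 F + sum4 G = sum4 (fun a b c d => F a b c d + G a b c d))%N.
  by rewrite -big_split; do 3!(apply: eq_bigr => ? _; rewrite -big_split /=).
have split s x : (6 * sum4 s + 3 * sum4 x
  = sum4 s + sum4 (fun a b c d => s c d a b)
  + sum4 (fun a b c d => s a c b d) + sum4 (fun a b c d => s b d a c)
  + sum4 (fun a b c d => s a d b c) + sum4 (fun a b c d => s b c a d)
  + sum4 x + sum4 (fun a b c d => x a c b d)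
  + sum4 (fun a b c d => x a d b c))%N.
  rewrite (sum4_swap_pairs s) (sum4_swap23 s) (sum4_swap23 x).
  rewrite (s1 s) (s1 x) (s2 s) (s3 s).
  by move: (sum4 s) (sum4 x) => u v; lia.
rewrite split !E -sum4_uniq big_distrr; apply: leq_sum => a _.
rewrite big_distrr; apply: leq_sum => b _.
rewrite big_distrr; apply: leq_sum => c _.
rewrite big_distrr; apply: leq_sum => d _; exact: separates_crosses_le.
Qed.

(** * Sum and first moment of the numbers of at-most-k-edges *)

Definition num_le_pairs k := (\sum_p \sum_(q | p != q) (r p q <= k))%N.

Let sum_const_pairs m : (\sum_(p : V) \sum_(q | p != q) m = n * n.-1 * m)%N.
Proof.
under eq_bigr => p _.
  rewrite sum_nat_const (_ : #|_| = n.-1); last first.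
    by rewrite -(cardC1 p); apply: eq_card => q; rewrite !inE eq_sym.
  over.
by rewrite sum_nat_const mulnA.
Qed.

Let sum_pairs_swap (F : V -> V -> nat) :
  (\sum_p \sum_(q | p != q) F q p = \sum_p \sum_(q | p != q) F p q)%N.
Proof.
rewrite (exchange_big_dep predT) //=; apply: eq_bigr => p _.
by apply: eq_bigl => q; rewrite eq_sym.
Qed.

(** Each directed edge is paired with its reverse: together they have [n - 2] points to their
    right. *)
Lemma sum_card_right :
  (2 * \sum_p \sum_(q | p != q) r p q = n * n.-1 * n.-2)%N.
Proof.
rewrite mul2n -addnn -{1}sum_pairs_swap -big_split -sum_const_pairs /=.
apply: eq_bigr => p _; rewrite -big_split /=; apply: eq_bigr => q pq.
by rewrite -(card_right_swap pq) addn2 addnC.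
Qed.

(** A pair with [r p q = j] is counted for [k = j, ..., n - 3], that is [n - 2 - j = r q p] times;
    reversing all pairs reduces to [sum_card_right]. *)
Lemma sum_num_le_pairs :
  (2 * \sum_(0 <= k < n.-2) num_le_pairs k = n * n.-1 * n.-2)%N.
Proof.
suff -> : (\sum_(0 <= k < n.-2) num_le_pairs k
           = \sum_p \sum_(q | p != q) r p q)%N by exact: sum_card_right.
rewrite exchange_big -sum_pairs_swap /=; apply: eq_bigr => p _.
rewrite exchange_big; apply: eq_bigr => q pq.
rewrite sum_geq_indicator -(card_right_swap pq) addn2 /= ?leq_addr //.
by rewrite addKn.
Qed.

(* From [r (r - 1) + r (n - 2 - r) = r (n - 3)], with [r = r p q] and
   [n - 2 - r = r q p]. *)
Lemma sum_mul_num_le_pairs :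
  (4 * \sum_(0 <= k < n.-2) k * num_le_pairs k
   = n * n.-1 * (n.-2 * (n - 3)) + 2 * \sum_p \sum_q r p q * r q p)%N.
Proof.
have e1 : (\sum_(0 <= k < n.-2) k * num_le_pairs k
           + \sum_p \sum_(q | p != q) 'C(r p q, 2)
           = n * n.-1 * 'C(n.-2, 2))%N.
  rewrite -sum_const_pairs.
  under eq_bigr do rewrite big_distrr /=.
  rewrite exchange_big -big_split /=; apply: eq_bigr => p _.
  under eq_bigr do rewrite big_distrr /=.
  rewrite exchange_big -big_split /=; apply: eq_bigr => q pq.
  by rewrite sum_mul_geq_indicator // -(card_right_swap pq) addn2 leq_addr.
have e2 : (2 * \sum_p \sum_(q | p != q) 'C(r p q, 2)
    + \sum_p \sum_q r p q * r q p
    = (\sum_p \sum_(q | p != q) r p q) * (n - 3))%N.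
  rewrite big_distrr big_distrl -big_split /=; apply: eq_bigr => p _.
  (* The sum of products also ranges over the diagonal, which contributes nothing. *)
  have r0 : r p p = 0%N.
    apply: eq_card0 => x; rewrite inE.
    by apply/negbTE; rewrite -leNgt; have := D_swap p p x; lra.
  rewrite [X in (_ + X)%N](bigD1 p) //= r0 mul0n add0n.
  rewrite [X in (_ + X)%N](eq_bigl (fun q => p != q)); last first.
    by move=> q; rewrite eq_sym.
  rewrite big_distrr big_distrl -big_split /=; apply: eq_bigr => q pq.
  rewrite mul2_bin2.
  rewrite -(card_right_swap pq); move: (r p q) (r q p) => [|x] y; nia.
have e3 := sum_card_right.
have e4 : (2 * 'C(n.-2, 2) = n.-2 * (n - 3))%N.
  by rewrite mul2_bin2; congr (_ * _)%N; lia.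
nia.
Qed.

End Orientation.

(** * Crossing pairs of edges versus ordered quadruples *)

Lemma card_crossing_pairs_le (R : realDomainType) (V : finType)
    (D : V -> V -> V -> R) (C : {set {set {set V}}}) :
  (forall p q x, D q p x = - D p q x) ->
  (forall p q x, D q x p = D p q x) ->
  (forall P, P \in C -> exists a b c d,
     P = [set [set a; b]; [set c; d]] /\ crosses D a b c d) ->
  (8 * #|C| <= \sum_a \sum_b \sum_c \sum_d crosses D a b c d)%N.
Proof.
move=> D_swap D_cycle CP.
have sw1 a b c d : crosses D b a c d = crosses D a b c d.
  rewrite /crosses /separates !(D_swap a b) mulrNN.
  by rewrite [_ * D c d a]mulrC.
have sw2 a b c d : crosses D c d a b = crosses D a b c d.
  by rewrite /crosses andbC.
have sw3 a b c d : crosses D a b d c = crosses D a b c d.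
  by rewrite -sw2 sw1 sw2.
under eq_bigr do under eq_bigr do rewrite pair_bigA.
rewrite pair_bigA pair_bigA /=.
pose g (t : (V * V) * (V * V)) := [set [set t.1.1; t.1.2]; [set t.2.1; t.2.2]].
(* Quadruples are grouped by the unordered pair of edges they span. The fibre over each [P] in [C]
   contains the eight reorderings in [l]: swap the ends of either edge, or the two edges. *)
rewrite (partition_big g predT) //= mulnC -sum_nat_const big_mkcond /=.
apply: leq_sum => P _; case: ifP => // /CP[a [b [c [d [-> X]]]]].
have := separates_uniq D_swap D_cycle (andP X).1.
rewrite /= !inE !negb_or => /and4P[/and3P[ab ac ad] /andP[bc bd] cd _].
pose l := [:: ((a, b), (c, d)); ((b, a), (c, d)); ((a, b), (d, c));
  ((b, a), (d, c)); ((c, d), (a, b)); ((c, d), (b, a)); ((d, c), (a, b));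
  ((d, c), (b, a))].
have ul : uniq l.
  rewrite /= !inE !xpair_eqE !negb_or.
  by rewrite ![b == a]eq_sym ![c == a]eq_sym ![d == a]eq_sym ![c == b]eq_sym
    ![d == b]eq_sym ![d == c]eq_sym (negPf ab) (negPf ac) (negPf ad)
    (negPf bc) (negPf bd) (negPf cd) ?andbF ?eqxx.
rewrite -[8%N]/(size l) -(card_uniqP ul) -sum1_card big_mkcond.
rewrite [leqRHS]big_mkcond; apply: leq_sum => t _; case: ifP => // tl.
suff /andP[-> ->] : (g t == [set [set a; b]; [set c; d]]) &&
    crosses D t.1.1 t.1.2 t.2.1 t.2.2 by [].
have s2 (x y : V) : [set x; y] = [set y; x] by rewrite setUC.
move: tl; rewrite !inE /g => /or4P[|||/or4P[|||/orP[]]] => /eqP-> /=;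
  rewrite ?(s2 b) ?(s2 d) ?(setUC [set [set c; d]]) ?eqxx //=.
- by rewrite sw1.
- by rewrite sw3.
- by rewrite sw1 sw3.
- by rewrite sw2.
- by rewrite sw3 sw2.
- by rewrite sw1 sw2.
by rewrite sw1 sw3 sw2.
Qed.

(** * The orientation determinant in the plane *)

Definition orient (R : realDomainType) (p q x : R * R) : R :=
  (q.1 - p.1) * (x.2 - p.2) - (q.2 - p.2) * (x.1 - p.1).

Lemma orient_swap (R : realDomainType) (p q x : R * R) :
  orient q p x = - orient p q x.
Proof. rewrite /orient; ring. Qed.

Lemma orient_cycle (R : realDomainType) (p q x : R * R) :
  orient q x p = orient p q x.
Proof. rewrite /orient; ring. Qed.

Lemma orient_plucker (R : realDomainType) (a b c d : R * R) :
  orient b c d - orient a c d + orient a b d - orient a b c = 0.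
Proof. rewrite /orient; ring. Qed.

Lemma orient_neq0 (R : realType) (S : {fset (R * R)}) (p q x : S) :
  general_position S -> uniq [:: p; q; x] ->
  orient (val p) (val q) (val x) != 0.
Proof.
move=> [gp _] u; apply/eqP => o0; apply: (gp _ _ _ u).
move: u; rewrite /= !inE negb_or => /andP[/andP[pq _] _].
(* The line through [p] with normal vector perpendicular to [q - p]; a zero determinant puts [x] on
   it. *)
exists ((val q).2 - (val p).2), ((val p).1 - (val q).1).
exists (((val q).2 - (val p).2) * (val p).1
        + ((val p).1 - (val q).1) * (val p).2); split.
  move=> [e1 e2]; case/eqP: pq; apply: val_inj.
  move: e1 e2 => /subr0_eq e1 /subr0_eq e2.
  by rewrite [LHS]surjective_pairing e2 -e1 -surjective_pairing.
by move: o0; rewrite /orient => o0; split=> //; lra.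
Qed.

(** The function [orient a b] is affine, so its value at [x], which is zero, interpolates its values
    at [c] and [d]. *)
Lemma orient_common_point (R : realType) (a b c d x : R * R) :
  open_segment a b x -> open_segment c d x ->
  exists2 u, 0 < u < 1 & (1 - u) * orient a b c + u * orient a b d = 0.
Proof.
move=> [t [_ x1 x2]] [u [u01 y1 y2]]; exists u => //.
have : orient a b x = 0 by rewrite /orient x1 x2; ring.
by rewrite {1}/orient y1 y2 => <-; rewrite /orient; ring.
Qed.

Lemma open_segment_separates (R : realType) (S : {fset (R * R)})
    (a b c d : S) (x : R * R) :
  general_position S -> a != b -> c != d ->
  [set a; b] != [set c; d] :> {set S} ->
  open_segment (val a) (val b) x -> open_segment (val c) (val d) x ->
  separates (fun p q z : S => orient (val p) (val q) (val z)) a b c d.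
Proof.
move=> gp ab cd ef abx cdx.
have [u /andP[u0 u1]] := orient_common_point abx cdx.
have diag y : y \in [set a; b] -> orient (val a) (val b) (val y) = 0.
  by rewrite !inE => /orP[]/eqP->; rewrite /orient; ring.
have ndiag y : y \notin [set a; b] -> orient (val a) (val b) (val y) != 0.
  rewrite !inE negb_or => /andP[ya yb]; apply: orient_neq0 => //.
  by rewrite /= !inE negb_or ab !(eq_sym _ y) ya yb.
(* If [c] or [d] is an endpoint of [ab], one term of the relation vanishes, hence so does the other.
   This makes the two edges equal or contradicts [orient_neq0]. *)
rewrite /separates; have [cab|/ndiag c0] := boolP (c \in [set a; b]).
  rewrite (diag _ cab) mulr0 add0r => /eqP; rewrite mulf_eq0 gt_eqF //= => d0.
  have dab : d \in [set a; b] by apply: contraTT d0 => /ndiag.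
  case/eqP: ef; apply/esym/eqP; rewrite eqEcard !cards2 ab cd andbT.
  apply/subsetP => y; rewrite !inE => /orP[]/eqP->; move: cab dab;
    by rewrite !inE.
have [dab|/ndiag d0] := boolP (d \in [set a; b]).
  rewrite (diag _ dab) mulr0 addr0 => /eqP.
  by rewrite mulf_eq0 (negPf c0) orbF subr_eq0 gt_eqF.
move: c0 d0; set y := orient _ _ _; set z := orient _ _ _ => y0 z0 e.
have ez : z = - ((1 - u) / u) * y.
  apply: (mulfI (lt0r_neq0 u0)).
  by rewrite !mulrA mulrN mulrCA divff ?gt_eqF //; lra.
rewrite ez mulrCA pmulr_llt0; first by rewrite oppr_lt0 divr_gt0 // subr_gt0.
by rewrite -expr2 exprn_even_gt0.
Qed.

Lemma crossing_number_le (R : realType) (S : {fset (R * R)}) :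
  general_position S ->
  (8 * crossing_number S <= \sum_a \sum_b \sum_c \sum_d
     crosses (fun p q z : S => orient (val p) (val q) (val z)) a b c d)%N.
Proof.
move=> gp; apply: card_crossing_pairs_le => [p q x|p q x|P].
- exact: orient_swap.
- exact: orient_cycle.
rewrite inE => /asboolP[e [f [-> [/eqP ef [x [abx cdx]]]]]].
case: abx cdx => [a [b [/eqP ab eE abx]]] [c [d [/eqP cd fE cdx]]].
exists a, b, c, d; split; first by rewrite eE fE.
move: ef; rewrite eE fE => ef.
by apply/andP; split; apply: (@open_segment_separates _ _ _ _ _ _ x) => //;
  rewrite eq_sym.
Qed.

(** * Values of [pE] and its derivative at 1, and the conclusion *)

Lemma num_le_kedgesE (R : realType) (S : {fset (R * R)}) (k : nat) :
  num_le_kedges S k =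
  num_le_pairs (fun p q z : S => orient (val p) (val q) (val z)) k.
Proof.
rewrite /num_le_kedges /num_jedges /num_le_pairs pair_big_dep /=.
under eq_bigr do rewrite -sum1dep_card big_mkcond.
rewrite exchange_big [RHS]big_mkcond /=; apply: eq_bigr => -[p q] _ /=.
rewrite /is_jedge /=; case: (p != q) => /=; last by rewrite big1.
(* Here [right_of] unfolds to negativity of [orient], and each ordered pair is a [j]-edge for
   exactly one [j]. *)
rewrite -big_mkcond; exact: sum_eq_indicator.
Qed.

Lemma pE_poly (R : realType) (S : {fset (R * R)}) :
  pE S = \poly_(k < (#|` S| - 3).+1) (num_le_kedges S k)%:R.
Proof. by rewrite /pE big_mkord poly_def. Qed.

Lemma horner_pE1 (R : realType) (S : {fset (R * R)}) :
  (pE S).[1] = (\sum_(0 <= k < (#|` S| - 3).+1) num_le_kedges S k)%:R%:C%C.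
Proof.
rewrite /pE horner_sum !rmorph_nat natr_sum; apply: eq_bigr => k _.
by rewrite hornerZ hornerXn expr1n mulr1.
Qed.

Lemma horner_deriv_pE1 (R : realType) (S : {fset (R * R)}) :
  (pE S)^`().[1]
  = (\sum_(0 <= k < (#|` S| - 3).+1) k * num_le_kedges S k)%:R%:C%C.
Proof.
rewrite /pE raddf_sum horner_sum !rmorph_nat natr_sum; apply: eq_bigr => k _.
by rewrite /= derivZ derivXn hornerZ hornerMn hornerXn expr1n natrM mulrC.
Qed.

Lemma leq_num_le_kedges (R : realType) (S : {fset (R * R)}) :
  {homo num_le_kedges S : j k / (j <= k)%N}.
Proof.
move=> j k jk; rewrite /num_le_kedges [leqRHS](big_cat_nat (n := j.+1)) //=.
exact: leq_addr.
Qed.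

Theorem theorem16 (R : realType) (n : nat) (S : {fset (R * R)}) (alpha : R)
  (n_gt3 : (3 < n)%N) (card_S : #|` S| = n) (gp_S : general_position S)
  (cr_S : (crossing_number S)%:R = alpha * 'C(n, 4)%:R) :
  exists z : R[i], root (pE S) z /\
    ((3 + alpha) / (9 - alpha))%:C%C <= `|z|.
Proof.
set D := fun p q z : S => orient (val p) (val q) (val z).
have sw p q x : D q p x = - D p q x by apply: orient_swap.
have cy p q x : D q x p = D p q x by apply: orient_cycle.
have n0 p q x : uniq [:: p; q; x] -> D p q x != 0 by apply: orient_neq0.
have pl a b c d : D b c d - D a c d + D a b d - D a b c = 0.
  exact: orient_plucker.
have cS : #|{: S}| = n by rewrite -card_S cardfE.
have := sum_right_crosses_le sw cy n0 pl.
have := crossing_number_le gp_S.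
have := sum_num_le_pairs sw cy n0.
have := sum_mul_num_le_pairs sw cy n0.
rewrite -/D cS.
under eq_bigr do rewrite -num_le_kedgesE.
under [X in (2 * X)%N = _]eq_bigr do rewrite -num_le_kedgesE.
set T := (\sum_p \sum_q _)%N; set X := (\sum_a _)%N.
set cr := crossing_number S.
set B := (\sum_(0 <= k < _) _ * _)%N; set A := (\sum_(0 <= k < _) _)%N.
move=> eB eA leX leT.
have eN : (24 * 'C(n, 4) = n * n.-1 * (n.-2 * (n - 3)))%N.
  rewrite mulnC -[24%N]/(4`!)%N bin_ffact.
  by rewrite !ffactnS ffactn0 muln1 (_ : n.-1.-1.-1 = n - 3)%N ?mulnA //; lia.
(* From [12 T + 3 X <= 72 C(n, 4)] and [8 cr <= X] follows [T <= 6 C(n, 4) - 2 cr]; insert this into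
   [4 B = 24 C(n, 4) + 2 T]. *)
have leBc : (B + cr <= 9 * 'C(n, 4))%N by lia.
have lec : (cr <= 3 * 'C(n, 4))%N by lia.
have n3 : (#|` S| - 3).+1 = n.-2 by rewrite card_S; lia.
have C0 : (0 < 'C(n, 4))%N by rewrite bin_gt0.
have A0 : (0 < A)%N.
  by rewrite -(ltn_pmul2l (m := 2)) // muln0 eA !muln_gt0; lia.
have szp : size (pE S) = (n - 4).+2.
  rewrite pE_poly n3 size_poly_eq; first by lia.
  (* The leading coefficient is the largest one by monotonicity; if it vanished, so would the sum
     [A]. *)
  rewrite pnatr_eq0 -lt0n; move: A0; apply: contraTT; rewrite -!leqNgt !leqn0.
  move=> /eqP E0; rewrite /A big_nat big1 // => k /andP[_ kn]; apply/eqP.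
  by rewrite -leqn0 -E0 leq_num_le_kedges //; lia.
pose C : R := 'C(n, 4)%:R.
have CR : 0 < C by rewrite ltr0n.
have crR : cr%:R = alpha * C by [].
have lecR : cr%:R <= 3 * C by rewrite -natrM ler_nat.
have leBR : B%:R + cr%:R <= 9 * C by rewrite -natrM -natrD ler_nat.
have a0 : 0 <= alpha by rewrite -(pmulr_lge0 _ CR) -crR ler0n.
have a3 : alpha <= 3 by rewrite -(ler_pM2r CR) -crR.
(* The degree is [n - 3] and [A = 3 C(n, 3)], while [(n - 3) C(n, 3) = 4 C(n, 4)]. *)
have AC : (n - 4).+1%:R * A%:R = 12 * C.
  rewrite -!natrM; congr _%:R; apply/eqP.
  rewrite -(eqn_pmul2l (m := 2)) // [(2 * (12 * _))%N]mulnA eN mulnCA eA.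
  by rewrite (_ : (n - 4).+1 = n - 3)%N; [rewrite mulnC -!mulnA | lia].
apply: (exists_root_norm_ge szp (A := A%:R) (B := B%:R)).
- by rewrite ltr0n.
- by rewrite horner_pE1 n3.
- by rewrite horner_deriv_pE1 n3.
- apply/andP; split; first by apply: divr_ge0; lra.
  by rewrite ler_pdivrMr; lra.
(* Since [1 + r = 12 / (9 - alpha)], the required bound becomes [B <= (9 - alpha) C], which is
   [leBR]. *)
rewrite AC -(ler_pM2r (x := 9 - alpha)); last by lra.
have -> : B%:R * (1 + (3 + alpha) / (9 - alpha)) * (9 - alpha) = 12 * B%:R :> R.
  by field; apply: lt0r_neq0; lra.
by rewrite -mulrA ler_pM2l //; lra.
Qed.
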